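(* Let $n\ge 2$, let $\ell_1,\ldots,\ell_{n+3} \in R = K[x_0,\ldots,x_n]$ be $n+3$ linear forms in linearly general position, and let $d$ be a positive integer. Put \[ r = \begin{cases} \frac{(n+2)(d-1)}{2} & \text{if } n \text{ is even},\\[2pt] \left\lfloor \frac{(n+1)(n+3)(d-1)}{2(n+2)} \right\rfloor & \text{if } n \text{ is odd}. \end{cases} \] If $n$ is even, then $\dim_K [R/(\ell_1^d,\ldots,\ell_{n+3}^d)]_r = 1$. If $n$ is odd, then $\rho = \frac12 (n+1)(n+3)(d-1) - (n+2)r$ satisfies $0\le \rho\le n+1$, and if moreover $n+2$ divides $d-1$ or $d\ge n^2+n+2$, then \[ \dim_K [R/(\ell_1^d,\ldots,\ell_{n+3}^d)]_r = \binom{n+\rho}{n}. \]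
   Context: $K$ is an arbitrary field and $R = K[x_0,\ldots,x_n]$ has its standard grading; $[A]_j$ is the degree $j$ component of a graded algebra $A$. The linear form $a_0x_0+\cdots+a_nx_n$ is dual to the point $(a_0:\ldots:a_n)\in\mathbb{P}^n$. A finite set of linear forms is in linearly general position if the set of dual points is, i.e. every subset of $r'+1\le n+1$ of these points spans an $r'$-dimensional linear subspace of $\mathbb{P}^n$.
   Formalization: The two dimension formulas are stated only for K of characteristic 0 or characteristic greater than r, not for arbitrary K; for n = d = 2 in characteristic 2 the squares span at most 3 dimensions, so the dimension is at least 3, not 1. The bound on ρ holds for every K. *)

(* Defs.v *)
From HB Require Import structures.
From mathcomp Require Import all_boot all_order all_algebra.
From mathcomp.multinomials Require Export mpoly.

Set Implicit Arguments.
Unset Strict Implicit.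
Unset Printing Implicit Defensive.

Import GRing.Theory.
Local Open Scope ring_scope.

Section Defs.
Variables (K : fieldType) (n : nat).
Implicit Types (p : {mpoly K[n.+1]}) (I : {mpoly K[n.+1]} -> Prop).

Definition dual_point p : 'rV[K]_n.+1 := \row_j p@_(U_(j)).

(* A linear subspace of P^n of projective dimension r' is a vector subspace of
   dimension r' + 1, so k points span a (k-1)-dimensional linear subspace iff
   their coordinate vectors span a vector space of dimension k.  The case
   #|J| = 1 excludes zero forms and #|J| = 2 excludes coinciding points. *)
Definition linearly_general_position m (l : 'I_m -> {mpoly K[n.+1]}) : Prop :=
  forall J : {set 'I_m}, (#|J| <= n.+1)%N ->
    \dim <<[seq dual_point (l i) | i in J]>>%VS = #|J|.

Definition gen_ideal m (f : 'I_m -> {mpoly K[n.+1]}) p : Prop :=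
  exists q : 'I_m -> {mpoly K[n.+1]}, p = \sum_i q i * f i.

(* For a homogeneous ideal I, the component [R/I]_r is the image of [R]_r in
   R/I; a basis of it is given by forms of degree r whose classes modulo I are
   linearly independent and span the classes of all forms of degree r. *)
Definition graded_quot_basis I (r m : nat) (b : 'I_m -> {mpoly K[n.+1]}) :=
  [/\ forall i, b i \is r.-homog,
      forall c : 'I_m -> K, I (\sum_i c i *: b i) -> forall i, c i = 0
    & forall p, p \is r.-homog ->
        exists c : 'I_m -> K, I (p - \sum_i c i *: b i)].

(* dim_K [R/I]_r = m *)
Definition graded_quot_dim I (r m : nat) : Prop :=
  exists b : 'I_m -> {mpoly K[n.+1]}, graded_quot_basis I r b.

Lemma gen_ideal_lin m (f : 'I_m -> {mpoly K[n.+1]}) k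
    (c : 'I_k -> K) (p : 'I_k -> {mpoly K[n.+1]}) :
  (forall i, gen_ideal f (p i)) -> gen_ideal f (\sum_i c i *: p i).
Proof.
move=> /fin_all_exists [q qP].
exists (fun j => \sum_i c i *: q i j).
transitivity (\sum_i \sum_j (c i *: q i j) * f j).
  by apply: eq_bigr => i _; rewrite qP scaler_sumr; apply: eq_bigr => j _;
     rewrite scalerAl.
by rewrite exchange_big; apply: eq_bigr => j _; rewrite mulr_suml.
Qed.

Lemma graded_quot_dim_le m (f : 'I_m -> {mpoly K[n.+1]}) r d1 d2 :
  graded_quot_dim (gen_ideal f) r d1 -> graded_quot_dim (gen_ideal f) r d2 ->
  (d1 <= d2)%N.
Proof.
case=> b [bh bfree _] [b' [_ _ b'gen]].
have /fin_all_exists [C CP] : forall i, exists c : 'I_d2 -> K,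
    gen_ideal f (b i - \sum_j c j *: b' j) by move=> i; apply: b'gen.
pose M := \matrix_(i, j) C i j.
suff /eqP <- : row_free M by rewrite rank_leq_col.
rewrite -kermx_eq0; apply/eqP/row_matrixP => i; rewrite row0.
have : row i (kermx M) *m M = 0 by rewrite -row_mul mulmx_ker row0.
move: (row i _) => v vM.
apply/rowP => j; rewrite mxE; apply: (bfree (fun j => v 0 j)) => {j}.
have := gen_ideal_lin (fun j => v 0 j) CP.
rewrite (eq_bigr (fun i => v 0 i *: b i - \sum_j (v 0 i * C i j) *: b' j));
  last first.
  move=> k _; rewrite scalerBr scaler_sumr; congr (_ - _).
  by apply: eq_bigr => j _; rewrite scalerA.
rewrite sumrB exchange_big /= [X in _ - X]big1 ?subr0 // => j _.
rewrite -scaler_suml.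
suff -> : \sum_i v 0 i * C i j = 0 by rewrite scale0r.
have := congr1 (fun w : 'rV_d2 => w 0 j) vM; rewrite !mxE => {2}<-.
by apply: eq_bigr => k _; rewrite mxE.
Qed.

Lemma graded_quot_dim_uniq m (f : 'I_m -> {mpoly K[n.+1]}) r d1 d2 :
  graded_quot_dim (gen_ideal f) r d1 -> graded_quot_dim (gen_ideal f) r d2 ->
  d1 = d2.
Proof.
move=> h1 h2; apply/eqP; rewrite eqn_leq.
by rewrite (graded_quot_dim_le h1 h2) (graded_quot_dim_le h2 h1).
Qed.

End Defs.

(* Characteristic 0, or characteristic greater than r: [pchar K] is empty in
   the first case and is the singleton of the characteristic otherwise.  The
   dimension formulas fail without such a restriction: if n = d = 2 (so r = 2)
   and K has characteristic 2, the squares of linear forms lie in the span of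
   x_0^2, x_1^2, x_2^2, so the quotient has dimension 3 in degree 2, not 1. *)
Definition pchar0_or_gt (K : fieldType) (r : nat) : Prop :=
  forall p : nat, p \in [pchar K] -> (r < p)%N.

Definition crit_deg (n d : nat) : nat :=
  (if odd n then ((n + 1) * (n + 3) * (d - 1)) %/ (2 * (n + 2))
   else ((n + 2) * (d - 1)) %/ 2)%N.

(* Used for odd n only, where the division by 2 is exact.  It takes values in
   int, so that 0 <= rho is not built in by truncated subtraction. *)
Definition rho (n d : nat) : int :=
  (((n + 1) * (n + 3) * (d - 1)) %/ 2)%N%:Z
    - ((n + 2) * crit_deg n d)%N%:Z.

(* Main.v *)
(** By Macaulay duality (characteristic 0 or > r), [R/(l_k^d)]_r is dual to the
    space of forms of degree r that vanish to order at least r - (d - 1) at the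
    n + 3 dual points; more generally let V(r; b) be the space of forms of
    degree r vanishing to order at least r - b_k at the k-th point.  Put n + 1
    of the points at the coordinate points and let p, q be the other two.  The
    Cremona map y |-> pq/y sends y^m to a multiple of y^(b-m) and exchanges p
    and q, so with w = sum_k b_k - 2r it identifies V(r; b) with V(r'; b'),
    where b' replaces b_i by w - b_i at the two points and w is unchanged.
    Starting from b_k = e = d - 1 and flipping disjoint pairs of points replaces
    e by f = (n + 2)e - 2r.  For n even f = 0, and flipping all points but one
    leads to degree 0.  For n odd, flipping all points leads to degree rho with
    all b_k = f; since (n + 2)f = e + 2 rho, the hypothesis on d gives
    f >= rho, so that all vanishing conditions are void. *)

From HB Require Import structures.
Require Import Defs.
From mathcomp Require Import all_boot all_order all_algebra.
From mathcomp.multinomials Require Import ssrcomplements mpoly.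
From mathcomp Require Import zify ring.

Set Implicit Arguments.
Unset Strict Implicit.
Unset Printing Implicit Defensive.

Import GRing.Theory VectorInternalTheory.
Local Open Scope ring_scope.

(** * Taylor expansion of forms *)

Lemma homog_mdegP (R : nzRingType) n r (F : {mpoly R[n]}) :
  F \is r.-homog <-> (forall m, F@_m != 0 -> mdeg m = r).
Proof.
split=> [/dhomogP hF m | hF]; first by rewrite -mcoeff_msupp => /hF.
by apply/dhomogP => m; rewrite mcoeff_msupp => /hF.
Qed.

Section DirectionalDerivative.
Variables (K : fieldType) (n : nat).
Implicit Types (F G : {mpoly K[n.+1]}) (p : 'rV[K]_n.+1) (r b k : nat).

Definition dirderiv p F : {mpoly K[n.+1]} := \sum_s p 0 s *: F^`M(s).

Lemma dirderiv_linear p : linear (dirderiv p).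
Proof.
move=> c F G; rewrite /dirderiv scaler_sumr -big_split.
by apply: eq_bigr => s _; rewrite linearP scalerDr !scalerA mulrC.
Qed.

HB.instance Definition _ p := GRing.isLinear.Build K {mpoly K[n.+1]}
  {mpoly K[n.+1]} _ (dirderiv p) (dirderiv_linear p).

Lemma dirderiv_mderiv p s F : dirderiv p F^`M(s) = (dirderiv p F)^`M(s).
Proof.
rewrite /dirderiv linear_sum; apply: eq_bigr => i _.
by rewrite linearZ /= mderiv_comm.
Qed.

Lemma iter_dirderiv_mderiv p k s F :
  iter k (dirderiv p) F^`M(s) = (iter k (dirderiv p) F)^`M(s).
Proof. by elim: k => //= k ->; rewrite dirderiv_mderiv. Qed.

Lemma mderiv_homog r F s : F \is r.-homog -> F^`M(s) \is r.-1.-homog.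
Proof.
move=> /homog_mdegP hF; apply/homog_mdegP => m.
rewrite mcoeff_mderiv => h.
have /hF : F@_(m + U_(s)) != 0 by apply: contra h => /eqP->; rewrite mul0rn.
by rewrite mdegD mdeg1 addn1 => <-.
Qed.

Lemma mderiv_homog0 F s : F \is 0.-homog -> F^`M(s) = 0.
Proof.
move=> /homog_mdegP hF; apply/mpolyP => m; rewrite mcoeff_mderiv mcoeff0.
have [->|/hF] := eqVneq F@_(m + U_(s)) 0; first by rewrite mul0rn.
by rewrite mdegD mdeg1 addn1.
Qed.

Lemma iter_dirderiv_homog r F p k :
  F \is r.-homog -> iter k (dirderiv p) F \is (r - k).-homog.
Proof.
move=> hF; elim: k => [|k IH] /=; first by rewrite subn0.
by rewrite subnS rpred_sum // => s _; rewrite rpredZ // mderiv_homog.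
Qed.

Lemma iter_dirderiv_eq0 r F p k :
  F \is r.-homog -> (r < k)%N -> iter k (dirderiv p) F = 0.
Proof.
move=> hF ltrk; rewrite -(subnK ltrk) iterD.
suff -> : iter r.+1 (dirderiv p) F = 0 by rewrite iter_fix // linear0.
have := iter_dirderiv_homog p r hF; rewrite subnn => h0.
by rewrite /= [LHS]big1 // => s _; rewrite mderiv_homog0 ?scaler0.
Qed.

Section Evaluation.
Variables (S : comNzRingType) (f : {rmorphism K -> S}).
Implicit Types (u v : 'I_n.+1 -> S).

Lemma euler_homog r F u : F \is r.-homog ->
  \sum_s u s * mmap f u F^`M(s) = r%:R * mmap f u F.
Proof.
move=> /homog_mdegP hF; rewrite [in RHS]/mmap mulr_sumr.
under eq_bigr => s _ do rewrite /mderiv raddf_sum mulr_sumr /=.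
rewrite exchange_big /= big_seq [RHS]big_seq; apply: eq_bigr => m.
rewrite mcoeff_msupp => /hF <-; rewrite mdegE natr_sum mulr_suml; apply: eq_bigr => s _.
rewrite mmapZ mmapX rmorphM rmorph_nat /=.
have [->|ms0] := eqVneq (m s) 0%N; first by rewrite !mul0r mulr0.
rewrite -[in mmap1 u m](_ : U_(s) + (m - U_(s)) = m)%MM; last first.
  rewrite addmC submK //; apply/mnm_lepP => i; rewrite mnm1E.
  by case: eqVneq => // <-; rewrite lt0n.
rewrite [in RHS]commr_mmap1_M => [|i x]; last exact: mulrC.
rewrite mmap1U; ring.
Qed.

(* F(p + t v) = sum_j t^j (D_p^(r-j) F)(v) / (r-j)!, multiplied by r!. *)
Lemma taylor_homog r F p (t : S) v : F \is r.-homog ->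
  r`!%:R * mmap f (fun s => f (p 0 s) + t * v s) F =
  \sum_(j < r.+1) (r ^_ j)%:R * t ^+ j
                  * mmap f v (iter (r - j) (dirderiv p) F).
Proof.
elim: r F => [|r IH] F hF.
  rewrite big_ord1 /= ffactn0 fact0 expr0 !mul1r /mmap.
  move/homog_mdegP: hF => hF; apply: eq_big_seq => m.
  rewrite mcoeff_msupp => /hF /eqP.
  by rewrite mdeg_eq0 => /eqP ->; rewrite !mmap11.
pose u s := f (p 0 s) + t * v s.
(* Euler's identity at the point [p + t v] trades [F] for first derivatives of degree [r], to which
   the induction hypothesis applies. *)
have -> : (r.+1)`!%:R * mmap f u F =
  r`!%:R * mmap f u (dirderiv p F)
  + t * \sum_s v s * (r`!%:R * mmap f u F^`M(s)).
  rewrite factS mulnC natrM -mulrA -(euler_homog u hF).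
  rewrite /dirderiv raddf_sum /= !mulr_sumr -big_split /=.
  by apply: eq_bigr => s _; rewrite mmapZ /u; ring.
rewrite IH; last by have := iter_dirderiv_homog p 1 hF; rewrite subn1.
under [X in _ + t * X]eq_bigr => s _.
  rewrite IH ?(mderiv_homog s hF) // mulr_sumr.
  under eq_bigr => j _ do rewrite iter_dirderiv_mderiv.
  over.
rewrite exchange_big /= mulr_sumr.
have -> : \sum_(j < r.+1) t * (\sum_s v s * ((r ^_ j)%:R * t ^+ j
    * mmap f v (iter (r - j) (dirderiv p) F)^`M(s))) =
  \sum_(j < r.+1) (r ^_ j * j.+1)%:R * t ^+ j.+1
     * mmap f v (iter (r - j) (dirderiv p) F).
  apply: eq_bigr => j _.
  have /(euler_homog v) : iter (r - j) (dirderiv p) F \is j.+1.-homog.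
    have := iter_dirderiv_homog p (r - j) hF.
    by rewrite subSn ?leq_subr // subKn // -ltnS.
  move=> E; rewrite natrM [RHS](_ : _ = t * ((r ^_ j)%:R * t ^+ j *
    (j.+1%:R * mmap f v (iter (r - j) (dirderiv p) F)))); last first.
    by rewrite exprS; ring.
  rewrite -E; congr (t * _); rewrite mulr_sumr.
  by apply: eq_bigr => s _; ring.
rewrite [in RHS]big_ord_recl /= [X in X + _]big_ord_recl /= -addrA.
rewrite !ffactn0 !subn0 -iterSr; congr (_ + _).
(* The coefficients match by the Pascal-type rule [(r+1)^_(j+1) = r^_(j+1) + (j+1) r^_j] for falling
   factorials. *)
rewrite [in RHS](eq_bigr (fun j : 'I_r.+1 => (r ^_ j.+1)%:R * t ^+ j.+1
  * mmap f v (iter (r - j) (dirderiv p) F)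
  + (r ^_ j * j.+1)%:R * t ^+ j.+1
  * mmap f v (iter (r - j) (dirderiv p) F))); last first.
  move=> j _; rewrite -[bump 0 j]/j.+1 subSS -mulrDl -mulrDl -natrD.
  congr (_%:R * _ * _); rewrite ffactSS [(r ^_ j.+1)%N]ffactnSr.
  by have := ltn_ord j; nia.
rewrite big_split /= [X in _ = X + _]big_ord_recr /= ffact_small //.
rewrite !mul0r addr0; congr (_ + _); apply: eq_bigr => j _.
by rewrite -[bump 0 j]/j.+1 -iterSr -subSn // subSS.
Qed.

End Evaluation.
End DirectionalDerivative.

(** * Vanishing order at a point *)

Section VanishingOrder.
Variables (K : fieldType) (n : nat).
Implicit Types (F G : {mpoly K[n.+1]}) (p : 'rV[K]_n.+1) (r b m k : nat).

Local Notation S := {poly {mpoly K[n.+1]}}.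

Definition polyCC : K -> S := polyC \o @mpolyC n.+1 K.
HB.instance Definition _ := GRing.RMorphism.on polyCC.

(* Quantifying over polynomial directions v covers the generic line through p
   and, with all of K[y][t] allowed, every polynomial curve through p. *)
Definition vanish_order p m F := forall v : 'I_n.+1 -> S,
  exists g, mmap polyCC (fun s => polyCC (p 0 s) + 'X * v s) F = 'X^m * g.

Lemma natr_neq0_le r k :
  pchar0_or_gt K r -> (0 < k <= r)%N -> k%:R != 0 :> K.
Proof.
move=> hK /andP[k0 kr]; apply/negP => /eqP k0K.
have [q qP] := natf0_pchar k0 (introT eqP k0K).
have := hK _ qP; move/eqP: k0K; rewrite -(dvdn_pcharf qP) => /(dvdn_leq k0).
lia.
Qed.

Lemma fact_neq0 r k :
  pchar0_or_gt K r -> (k <= r)%N -> k`!%:R != 0 :> K.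
Proof.
move=> hK; elim: k => [|k IH] kr; first by rewrite oner_eq0.
by rewrite factS natrM mulf_neq0 ?IH 1?ltnW // (natr_neq0_le hK).
Qed.

Lemma mmap_polyC_mpolyX F :
  mmap polyCC (fun s => ('X_s : {mpoly K[n.+1]})%:P) F = F%:P.
Proof.
rewrite [in RHS](mpolyE F) rmorph_sum; apply: eq_bigr => m _ /=.
rewrite -mul_mpolyC rmorphM /= mpolyXE_id rmorph_prod; congr (_ * _).
by apply: eq_bigr => s _; rewrite rmorphXn.
Qed.

(** Along the generic line through [p], the coefficient of [t^j] is [D_p^(r-j) F] up to the factor
    [r^_j / r!], which is nonzero as [r!] is invertible in [K]. Its vanishing for all [j < r - b]
    amounts to the case [j = r - b - 1], since iterates of [D_p] beyond a zero one are zero. *)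
Lemma vanish_order_dirderiv r b p F : pchar0_or_gt K r -> F \is r.-homog ->
  vanish_order p (r - b) F <-> iter b.+1 (dirderiv p) F = 0.
Proof.
move=> hK hF; split=> [hp | h0 v].
  have [ltrb|ltbr] := leqP r b; first exact: iter_dirderiv_eq0 hF _.
  have [g] := hp (fun s => ('X_s : {mpoly K[n.+1]})%:P).
  move/(congr1 ( *%R r`!%:R)); rewrite (taylor_homog polyCC p 'X _ hF).
  under eq_bigr => j _ do rewrite mmap_polyC_mpolyX.
  rewrite /=; move/(congr1 (fun q : S => q`_(r - b.+1))).
  rewrite mulrCA coefXnM ifT; last by lia.
  have ltj : (r - b.+1 < r.+1)%N by lia.
  rewrite coef_sum (bigD1 (Ordinal ltj)) //= [X in _ + X]big1 ?addr0; last first.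
    move=> j /negPf nj; rewrite -mulrA mulrCA coefXnM.
    rewrite -polyC_natr -polyCM coefC.
    case: ltnP => // lej; rewrite subn_eq0.
    case: leqP => // le; case/negP: (negbT nj).
    by apply/eqP/val_inj => /=; lia.
  rewrite -mulrA mulrCA coefXnM ltnn subnn -polyC_natr -polyCM coefC eqxx.
  rewrite subKn // => /eqP; rewrite -scaler_nat -mul_mpolyC.
  have nz : (r ^_ (r - b.+1))%:R != 0 :> K.
    have: (r ^_ (r - b.+1) * (r - (r - b.+1))`!)%:R != 0 :> K.
      by rewrite ffact_fact ?leq_subr // (fact_neq0 hK).
    by rewrite natrM mulf_eq0 => /norP[].
  by rewrite mulr1 mulf_eq0 mpolyC_eq0 (negPf nz) => /eqP.
have nz := fact_neq0 hK (leqnn r).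
exists (polyCC (r`!%:R)^-1 * \sum_(j < r.+1 | (r - b <= j)%N)
  (r ^_ j)%:R * 'X ^+ (j - (r - b)) * mmap polyCC v (iter (r - j) (dirderiv p) F)).
apply: (@mulfI _ r`!%:R).
  by rewrite -(rmorph_nat polyCC) fmorph_eq0.
rewrite (taylor_homog polyCC p 'X v hF).
rewrite -(rmorph_nat polyCC r`!) mulrCA [polyCC _ * (_ * _)]mulrA -rmorphM divff // rmorph1 mul1r.
rewrite (bigID (fun j : 'I_r.+1 => (r - b <= j)%N)) /=.
rewrite [X in _ + X]big1 ?addr0 => [|j]; last first.
  rewrite -ltnNge => ltj; rewrite -(subnK (_ : b.+1 <= r - j)%N); last by lia.
  by rewrite iterD h0 iter_fix ?linear0 // raddf0 mulr0.
rewrite mulr_sumr; apply: eq_bigr => j lej.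
rewrite -[in 'X ^+ j](subnKC lej) exprD; ring.
Qed.
End VanishingOrder.

(** * Macaulay duality *)

Section HasDim.
Variables (K : fieldType) (n : nat).
Implicit Types (F G : {mpoly K[n]}) (P Q : {mpoly K[n]} -> Prop).

Definition has_dim P D := exists h : 'I_D -> {mpoly K[n]},
  [/\ forall i, P (h i),
      forall c : 'I_D -> K, \sum_i c i *: h i = 0 -> forall i, c i = 0
    & forall F, P F -> exists c : 'I_D -> K, F = \sum_i c i *: h i].

(** Maps that are mutually inverse only up to a nonzero scalar suffice; this is what the Cremona map
    provides. *)
Lemma has_dim_transfer (f g : {linear {mpoly K[n]} -> {mpoly K[n]}}) a P Q D :
  a != 0 ->
  (forall F, P F -> Q (f F)) -> (forall G, Q G -> P (g G)) ->
  (forall F, P F -> g (f F) = a *: F) -> (forall G, Q G -> f (g G) = a *: G) ->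
  has_dim Q D -> has_dim P D.
Proof.
move=> a0 PQ QP gf fg [h [hQ hfree hgen]].
exists (fun i => g (h i)); split=> [i|c c0|F PF]; first exact: QP.
  apply: hfree; apply: (scalerI a0); rewrite scaler0.
  transitivity (f (\sum_i c i *: g (h i))); last by rewrite c0 linear0.
  rewrite scaler_sumr linear_sum; apply: eq_bigr => i _.
  by rewrite [in RHS]linearZ /= fg // !scalerA mulrC.
have [c fF] := hgen _ (PQ _ PF); exists (fun i => a^-1 * c i).
apply: (scalerI a0); rewrite -gf // fF scaler_sumr linear_sum.
by apply: eq_bigr => i _; rewrite [LHS]linearZ scalerA mulrA divff ?mul1r.
Qed.

Lemma has_dim_iff P Q D : (forall F, P F <-> Q F) -> has_dim P D -> has_dim Q D.
Proof.
move=> PQ [h [hP hfree hgen]]; exists h; split=> // [i|F /PQ]; first exact/PQ.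
exact: hgen.
Qed.

End HasDim.

Section Apolarity.
Variables (K : fieldType) (n : nat).
Implicit Types (F G g : {mpoly K[n.+1]}) (r d k : nat).

(** The apolarity pairing: [g] acts on [F] as a differential operator with constant coefficients,
    and the result is evaluated at the origin. *)
Definition apair g F : K := \sum_(m <- msupp g) g@_m * (F^`M[m])@_0%MM.

Lemma apairwE k g F : (msize g <= k)%N ->
  apair g F = \sum_(m : 'X_{1..n.+1 < k}) g@_m * (F^`M[m])@_0%MM.
Proof.
move=> legk; set I : subFinType _ := 'X_{1..n.+1 < k}.
rewrite /apair (big_mksub I) ?msupp_uniq //=; last first.
  by move=> x /msize_mdeg_lt /leq_trans; apply.
by rewrite big_rmcond //= => j /memN_msupp_eq0 ->; rewrite mul0r.
Qed.

Definition apairl F g := apair g F.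

Lemma apairl_linear F : linear_for *%R (apairl F).
Proof.
rewrite /apairl => c g1 g2; pose k := maxn (msize (c *: g1 + g2)) (maxn (msize g1) (msize g2)).
rewrite !(@apairwE k) ?leq_max ?leqnn ?orbT // mulr_sumr -big_split.
by apply: eq_bigr => m _; rewrite mcoeffD mcoeffZ mulrDl mulrA.
Qed.

HB.instance Definition _ F := GRing.isLinear.Build K {mpoly K[n.+1]} K
  *%R (apairl F) (apairl_linear F).

Lemma apair_linear g : linear_for *%R (apair g).
Proof.
move=> c F G; rewrite /apair mulr_sumr -big_split; apply: eq_bigr => m _.
by rewrite linearP mcoeffD mcoeffZ /=; ring.
Qed.

HB.instance Definition _ g := GRing.isLinear.Build K {mpoly K[n.+1]} K
  *%R (apair g) (apair_linear g).

Lemma apair_suml I (s : seq I) (g : I -> {mpoly K[n.+1]}) F :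
  apair (\sum_(i <- s) g i) F = \sum_(i <- s) apair (g i) F.
Proof. exact: (raddf_sum (apairl F)). Qed.

Lemma apairZl c g F : apair (c *: g) F = c * apair g F.
Proof. exact: (scalarZ (apairl F)). Qed.

Definition mfact (m : 'X_{1..n.+1}) : nat := (\prod_(i < n.+1) (m i)`!)%N.

Lemma apairX m F : apair 'X_[m] F = F@_m * (mfact m)%:R.
Proof.
rewrite /apair msuppX big_seq1 mcoeffX eqxx mul1r mcoeff_mderivm addm0.
by rewrite mulr_natr; under eq_bigr => i _ do rewrite ffactnn.
Qed.

Lemma mfact_neq0 r m : pchar0_or_gt K r -> mdeg m = r -> (mfact m)%:R != 0 :> K.
Proof.
move=> hK hm; rewrite natr_prod; apply/prodf_neq0 => i _; apply: (fact_neq0 hK).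
by rewrite -hm mdegE (bigD1 i) //= leq_addr.
Qed.

Lemma apair_eq0 r F : pchar0_or_gt K r -> F \is r.-homog ->
  (forall m, mdeg m = r -> apair 'X_[m] F = 0) -> F = 0.
Proof.
move=> hK /homog_mdegP hF h0; apply/mpolyP => m; rewrite mcoeff0; apply/eqP.
apply/negPn/negP => Fm; have hm := hF _ Fm.
move/eqP: (h0 _ hm); rewrite apairX mulf_eq0 (negPf Fm).
by rewrite (negPf (mfact_neq0 hK hm)).
Qed.

Lemma apair_monomial m g : apair g 'X_[m] = g@_m * (mfact m)%:R.
Proof.
rewrite (mpolyE g) apair_suml raddf_sum mulr_suml; apply: eq_bigr => m' _ /=.
rewrite apairZl apairX mcoeffZ !mcoeffX eq_sym -mulrA.
by case: eqVneq => [->|_]; rewrite ?mul0r.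
Qed.

Lemma apairMX s g F : apair ('X_s * g) F = apair g F^`M(s).
Proof.
rewrite (mpolyE g) mulr_sumr !apair_suml; apply: eq_bigr => m _.
rewrite -scalerAr !apairZl -mpolyXD /apair !msuppX !big_seq1 !mcoeffX !eqxx.
by rewrite mderivmDm mderivmU1m.
Qed.

Lemma linear_formE l : l \is 1.-homog ->
  l = \sum_s (dual_point l) 0 s *: 'X_s :> {mpoly K[n.+1]}.
Proof.
move=> /homog_mdegP hl; apply/mpolyP => m; rewrite raddf_sum /=.
have [/eqP/mdeg1P [s /eqP ->]|hm] := eqVneq (mdeg m) 1%N.
  rewrite (bigD1 s) //= mcoeffZ mcoeffX eqxx mulr1 mxE big1 ?addr0 // => i.
  by move=> /negPf ni; rewrite mcoeffZ mcoeffX eq_mnm1 ni mulr0.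
rewrite big1 => [|s _].
  by apply/eqP/negPn/negP => /hl /eqP; rewrite (negPf hm).
rewrite mcoeffZ mcoeffX; case: eqVneq => [E|]; last by rewrite mulr0.
by rewrite -E mdeg1 in hm.
Qed.

(** Multiplication by [X_s] is adjoint to the [s]-th partial derivative, so multiplication by [l] is
    adjoint to the derivative in the direction of its dual point. *)
Lemma apairM_linear_form l g F : l \is 1.-homog ->
  apair (l * g) F = apair g (dirderiv (dual_point l) F).
Proof.
move=> hl; rewrite {1}(linear_formE hl) mulr_suml apair_suml linear_sum.
by apply: eq_bigr => s _; rewrite -scalerAl apairZl apairMX linearZ.
Qed.

Lemma apairM_linear_formX l d g F : l \is 1.-homog ->
  apair (l ^+ d * g) F = apair g (iter d (dirderiv (dual_point l)) F).
Proof.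
move=> hl; elim: d F => [|d IH] F; first by rewrite mul1r.
by rewrite exprS -mulrA apairM_linear_form // IH -iterSr.
Qed.

End Apolarity.

Section Duality.
Variables (K : fieldType) (n N : nat) (l : 'I_N -> {mpoly K[n.+1]}) (r d : nat).
Hypothesis l_homog : forall k, l k \is 1.-homog.
Hypothesis char_gt : pchar0_or_gt K r.

Local Notation I := (gen_ideal (fun k => l k ^+ d)).

(** By adjointness these are the forms of degree [r] orthogonal to the degree [r] part of [I]. *)
Definition inverse_system (F : {mpoly K[n.+1]}) :=
  F \is r.-homog /\
  forall k, iter d (dirderiv (dual_point (l k))) F = 0.

Local Notation monos := [pred m : 'X_{1..n.+1 < r.+1} | mdeg m == r].
Local Notation mon i := (bmnm (enum_val (i : 'I_#|monos|))).

Lemma mon_deg (i : 'I_#|monos|) : mdeg (mon i) = r.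
Proof. by apply/eqP; exact: (enum_valP i). Qed.

Lemma mon_surj m : mdeg m = r -> exists i : 'I_#|monos|, mon i = m.
Proof.
move=> hm; have ltm : (mdeg m < r.+1)%N by rewrite hm.
have hin : BMultinom ltm \in monos by rewrite inE /= hm.
by exists (enum_rank_in hin (BMultinom ltm)); rewrite enum_rankK_in.
Qed.

Let coefs (g : {mpoly K[n.+1]}) : 'rV[K]_#|monos| := \row_i g@_(mon i).

Let coefs_linear : linear coefs.
Proof. by move=> c g h; apply/rowP => i; rewrite !mxE mcoeffD mcoeffZ. Qed.

HB.instance Definition _ := GRing.isLinear.Build K {mpoly K[n.+1]}
  'rV[K]_#|monos| _ coefs coefs_linear.

Let coefs_eq0 g : g \is r.-homog -> coefs g = 0 -> g = 0.
Proof.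
move=> /homog_mdegP hg g0; apply/mpolyP => m; rewrite mcoeff0.
have [//|/hg /mon_surj[i <-]] := eqVneq g@_m 0.
by have := congr1 (fun u : 'rV_ _ => u 0 i) g0; rewrite !mxE.
Qed.

(** Division by [m!] turns the pairing with [form_of c] into the plain dot product with [c]. *)
Let form_of (c : 'cV[K]_#|monos|) : {mpoly K[n.+1]} :=
  \sum_i (c i 0 / (mfact (mon i))%:R) *: 'X_[mon i].

Let form_of_homog c : form_of c \is r.-homog.
Proof. by apply: rpred_sum => i _; rewrite rpredZ // dhomogX; apply/eqP/mon_deg. Qed.

Let apair_form_of g c : apair g (form_of c) = (coefs g *m c) 0 0.
Proof.
rewrite mxE /form_of [LHS]linear_sum; apply: eq_bigr => i _.
rewrite linearZ /= apair_monomial mxE.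
by field; exact: mfact_neq0 char_gt (mon_deg i).
Qed.

Local Notation gens := ('I_N * 'X_{1..n.+1 < r.+1})%type.

(** The products [l_k^d x^m] of degree [r] span the degree [r] part of [I]; the default 0 in other
    degrees keeps the index type a plain product. *)
Let gen (x : gens) : {mpoly K[n.+1]} :=
  if (d + mdeg x.2 == r)%N then l x.1 ^+ d * 'X_[x.2] else 0.

Let gen_ideal_sum (s : seq gens) (c : gens -> K) :
  I (\sum_(x <- s) c x *: gen x).
Proof.
exists (fun k => \sum_(x <- s | x.1 == k)
   (if (d + mdeg x.2 == r)%N then c x *: 'X_[x.2] else 0)).
under [RHS]eq_bigr => k _ do rewrite mulr_suml.
rewrite (exchange_big_dep predT) //=; apply: eq_bigr => x _.
rewrite (eq_bigl (fun k => k == x.1)) => [|k]; last by rewrite eq_sym.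
rewrite big_pred1_eq /gen; case: ifP => _; last by rewrite mul0r scaler0.
by rewrite mulrC scalerAl.
Qed.

Let gen_homog x : gen x \is r.-homog.
Proof.
rewrite /gen; case: eqP => [hx|_]; last exact: rpred0.
have := dhomogMn d (l_homog x.1); rewrite mul1n => h.
have hX : 'X_[K, x.2] \is (mdeg x.2).-homog by rewrite dhomogX.
by have := dhomogM h hX; rewrite hx.
Qed.

Let genmx : 'M[K]_(#|{: gens}|, #|monos|) :=
  \matrix_i coefs (gen (enum_val i)).

Let mulmx_col m1 m2 (u : 'rV[K]_m1) (A : 'M_(m1, m2)) j :
  (u *m col j A) 0 0 = (u *m A) 0 j.
Proof. by rewrite !mxE; apply: eq_bigr => i _; rewrite mxE. Qed.

(** A column of the cokernel matrix is a functional that kills the degree [r] part of the ideal. By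
    adjointness, the [d]-th derivative of the corresponding form pairs to zero with every monomial
    of degree [r - d], hence vanishes. *)
Let inverse_system_coker (j : 'I_#|monos|) :
  inverse_system (form_of (col j (cokermx genmx))).
Proof.
split=> [|k]; first exact: form_of_homog.
set F := form_of _; have hF : F \is r.-homog by exact: form_of_homog.
have [ltrd|ledr] := ltnP r d; first exact: iter_dirderiv_eq0 hF ltrd.
have hK' : pchar0_or_gt K (r - d).
  by move=> p /char_gt; apply: leq_ltn_trans; exact: leq_subr.
apply: (apair_eq0 hK' (iter_dirderiv_homog _ _ hF)) => m hm.
rewrite -apairM_linear_formX // apair_form_of.
have ltm : (mdeg m < r.+1)%N by rewrite hm ltnS leq_subr.
have -> : l k ^+ d * 'X_[m] = gen (k, BMultinom ltm).
  by rewrite /gen /= hm subnKC // eqxx.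
have -> : coefs (gen (k, BMultinom ltm)) =
    row (enum_rank (k, BMultinom ltm)) genmx.
  by rewrite rowK enum_rankK.
by rewrite mulmx_col -row_mul mulmx_coker row0 mxE.
Qed.

(** A basis [h] of the inverse system has a dual family [b] of forms under the pairing. Elements of
    [I] pair to zero with [h], so [b] is independent modulo [I]; a form orthogonal to all of [h]
    lies in [I] by the cokernel criterion for row spaces. *)
Lemma graded_quot_dim_inverse_system D :
  has_dim inverse_system D -> graded_quot_dim I r D.
Proof.
move=> [h [hV hfree hgen]].
pose B := \matrix_(j < D, i < #|monos|) apair 'X_[mon i] (h j).
have /row_freeP[C BC] : row_free B.
  apply: inj_row_free => v vB; apply/rowP => j; rewrite [RHS]mxE.
  apply: (hfree (fun j => v 0 j)).
  apply: (apair_eq0 char_gt) => [|m /mon_surj[i <-]].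
    by apply: rpred_sum => i _; rewrite rpredZ //; case: (hV i).
  have := congr1 (fun u : 'rV_ _ => u 0 i) vB; rewrite !mxE => <-.
  by rewrite linear_sum; apply: eq_bigr => s _; rewrite linearZ mxE.
pose b j := \sum_i C i j *: 'X_[mon i] : {mpoly K[n.+1]}.
have b_homog j : b j \is r.-homog.
  by apply: rpred_sum => i _; rewrite rpredZ // dhomogX; apply/eqP/mon_deg.
have bh i j : apair (b i) (h j) = (i == j)%:R.
  have := congr1 (fun A : 'M_ _ => A j i) BC; rewrite !mxE eq_sym => <-.
  rewrite apair_suml; apply: eq_bigr => s _.
  by rewrite apairZl mxE mulrC.
exists b; split=> // [c [q qE] j | p hp].
  have : apair (\sum_i c i *: b i) (h j) = c j.
    rewrite apair_suml (bigD1 j) //= apairZl bh eqxx mulr1 big1 ?addr0 // => i.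
    by move=> /negPf ni; rewrite apairZl bh ni mulr0.
  move=> <-; rewrite qE apair_suml big1 // => k _; rewrite mulrC.
  by rewrite apairM_linear_formX //; case: (hV j) => _ ->; rewrite linear0.
exists (fun j => apair p (h j)); set p' := _ - _.
have hp' : p' \is r.-homog.
  by rewrite rpredB // rpred_sum // => j _; rewrite rpredZ.
have p'h j : apair p' (h j) = 0.
  rewrite [LHS](raddfB (apairl (h j))) /= /apairl apair_suml.
  rewrite (bigD1 j) //= apairZl bh eqxx mulr1 big1 ?addr0 ?subrr // => i.
  by move=> /negPf ni; rewrite apairZl bh ni mulr0.
have : (coefs p' <= genmx)%MS.
  rewrite submxE; apply/eqP/rowP => j; rewrite [RHS]mxE.
  have := apair_form_of p' (col j (cokermx genmx)).
  rewrite mulmx_col => <-.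
  have [c ->] := hgen _ (inverse_system_coker j).
  by rewrite linear_sum big1 // => i _; rewrite linearZ /= p'h mulr0.
case/submxP => v pv.
suff -> : p' = \sum_(x : gens) v 0 (enum_rank x) *: gen x.
  exact: gen_ideal_sum.
apply/eqP; rewrite -subr_eq0; apply/eqP/coefs_eq0.
  apply: rpredB => //; apply: rpred_sum => x _.
  by rewrite rpredZ // gen_homog.
rewrite linearB /= pv linear_sum mulmx_sum_row; apply/eqP; rewrite subr_eq0.
apply/eqP; rewrite [RHS](reindex (@enum_val _ predT)) /=; last first.
  by exists enum_rank => x _; rewrite ?enum_valK ?enum_rankK.
by apply: eq_bigr => i _; rewrite linearZ rowK /= enum_valK.
Qed.

End Duality.

(** * Linear substitutions and coordinate points *)

Lemma eq_mmap n (R S : nzRingType) (f : R -> S) (u v : 'I_n -> S) F :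
  u =1 v -> mmap f u F = mmap f v F.
Proof. by move=> uv; apply: eq_bigr => m _; rewrite (mmap1_eq _ uv). Qed.

Section LinearSubstitution.
Variables (K : fieldType) (n : nat).
Implicit Types (F G : {mpoly K[n.+1]}) (p : 'rV[K]_n.+1) (A B : 'M[K]_n.+1).

Definition lin_form B s : {mpoly K[n.+1]} := \sum_t B t s *: 'X_t.

Definition lin_subst B F : {mpoly K[n.+1]} :=
  mmap (@mpolyC n.+1 K) (lin_form B) F.

Lemma lin_subst_linear B : linear (lin_subst B).
Proof. by move=> c F G; rewrite /lin_subst mmapD mmapZ mul_mpolyC. Qed.

HB.instance Definition _ B := GRing.isLinear.Build K {mpoly K[n.+1]}
  {mpoly K[n.+1]} _ (lin_subst B) (lin_subst_linear B).

Lemma mmap_lin_subst (S : comNzRingType) (f : {rmorphism K -> S}) u B F :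
  mmap f u (lin_subst B F) = mmap f (fun s => \sum_t f (B t s) * u t) F.
Proof.
rewrite /lin_subst [mmap (@mpolyC _ _) _ _]/mmap raddf_sum; apply: eq_bigr => m _ /=.
rewrite rmorphM /= mmapC; congr (_ * _); rewrite rmorph_prod.
apply: eq_bigr => s _; rewrite rmorphXn /= raddf_sum; congr (_ ^+ _).
by apply: eq_bigr => t _; rewrite /= mmapZ mmapX mmap1U.
Qed.

Lemma lin_substM A B F : lin_subst A (lin_subst B F) = lin_subst (A *m B) F.
Proof.
rewrite {1}/lin_subst mmap_lin_subst; apply: eq_mmap => s.
rewrite /lin_form; under eq_bigr => t _ do rewrite mulr_sumr.
rewrite exchange_big; apply: eq_bigr => q _ /=; rewrite mxE scaler_suml.
by apply: eq_bigr => t _; rewrite mul_mpolyC scalerA mulrC.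
Qed.

Lemma lin_subst1 F : lin_subst 1%:M F = F.
Proof.
rewrite [RHS]mpolyE; apply: eq_bigr => m _; rewrite mul_mpolyC; congr (_ *: _).
rewrite -mmap1_id; apply: mmap1_eq => s; rewrite /lin_form (bigD1 s) //=.
rewrite mxE eqxx scale1r big1 ?addr0 // => t /negPf nts.
by rewrite mxE nts scale0r.
Qed.

Lemma mmap1_homog (u : 'I_n.+1 -> {mpoly K[n.+1]}) m :
  (forall s, u s \is 1.-homog) -> mmap1 u m \is (mdeg m).-homog.
Proof.
move=> hu; rewrite /mmap1 mdegE.
apply: (big_rec2 (fun (k : nat) G => G \is k.-homog)) => [|s k G _ hG].
  exact: dhomog1.
by apply: dhomogM => //; have := dhomogMn (m s) (hu s); rewrite mul1n.
Qed.

Lemma lin_subst_homog B r F : F \is r.-homog -> lin_subst B F \is r.-homog.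
Proof.
move=> /homog_mdegP hF; rewrite /lin_subst /mmap big_seq.
apply: rpred_sum => m; rewrite mcoeff_msupp => /hF <-.
rewrite mul_mpolyC rpredZ // mmap1_homog // => s.
by apply: rpred_sum => t _; rewrite rpredZ // dhomogX /= mdeg1.
Qed.

(** The substitution is composition with [y |-> y *m B], and [(p + t v) B = p B + t (v B)] is again
    a polynomial curve, now through [p B]. *)
Lemma vanish_order_lin_subst B p m F :
  vanish_order (p *m B) m F -> vanish_order p m (lin_subst B F).
Proof.
move=> hF v; have [g gP] := hF (fun s => \sum_t polyCC n (B t s) * v t).
exists g; rewrite -gP mmap_lin_subst; apply: eq_mmap => s.
rewrite mxE rmorph_sum mulr_sumr -big_split; apply: eq_bigr => t _ /=.
rewrite rmorphM /=; ring.
Qed.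

End LinearSubstitution.

Section CoordinatePoints.
Variables (K : fieldType) (n : nat).
Implicit Types (F : {mpoly K[n.+1]}).

(** On a curve through the [s]-th coordinate point, every coordinate other than the [s]-th is
    divisible by [t], so a monomial [m] of degree [r] is divisible by [t^(r - m_s)]. *)
Lemma vanish_order_delta r b s F : F \is r.-homog ->
  vanish_order (delta_mx 0 s) (r - b) F <->
  (forall m, F@_m != 0 -> (m s <= b)%N).
Proof.
move=> /homog_mdegP hF; split=> [hv | hb v]; last first.
  rewrite /mmap big_seq.
  apply: (big_ind (fun x => exists g, x = 'X^(r - b) * g)).
  - by exists 0; rewrite mulr0.
  - by move=> x y [g ->] [h ->]; exists (g + h); rewrite mulrDr.
  move=> m; rewrite mcoeff_msupp => Fm; have mr := hF _ Fm; have mb := hb _ Fm.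
  rewrite /mmap1 (bigD1 s) //=.
  under eq_bigr => t ts.
    rewrite mxE eqxx /= (negPf ts) rmorph0 add0r exprMn.
    over.
  rewrite big_split /= prodrXr.
  have -> : (\sum_(t | t != s) m t = (r - b) + (r - m s - (r - b)))%N.
    by move: mr; rewrite mdegE (bigD1 s) //=; lia.
  rewrite exprD; set c := polyCC _ _; set x := (_ ^+ m s).
  set y := 'X^(_ - _ - _); set z := \prod_(_ | _) _.
  by exists (c * x * y * z); ring.
(* This direction keeps the coordinate [s] equal to 1, so that [m] becomes exactly [t^(r - m_s)]
   times the monomial with [x_s] removed; as the degree is fixed, distinct monomials cannot
   cancel. *)
pose v t : {poly {mpoly K[n.+1]}} := if t == s then 0 else ('X_t)%:P.
have [g gP] := hv v.
pose E (m : 'X_{1..n.+1}) := [multinom if t == s then 0%N else m t | t < n.+1].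
have mE m : mdeg m = (m s + mdeg (E m))%N.
  rewrite !mdegE (bigD1 s) //= [in RHS](bigD1 s) //= mnmE eqxx; congr (_ + _)%N.
  by apply: eq_bigr => t /negPf ts; rewrite mnmE ts.
have vE m : F@_m != 0 ->
  mmap1 (fun t => polyCC n (delta_mx 0 s 0 t : K) + 'X * v t) m
  = 'X^(r - m s) * ('X_[E m])%:P.
  move=> Fm; rewrite /mmap1 -(hF _ Fm) mE addKn mdegE mpolyXE_id rmorph_prod.
  rewrite -prodrXr -big_split; apply: eq_bigr => t _ /=; rewrite mnmE /v mxE eqxx /=.
  case: eqVneq => [->|ts]; first by rewrite rmorph1 mulr0 addr0 !expr0 expr1n mulr1.
  by rewrite rmorph0 add0r exprMn rmorphXn.
move=> m0 Fm0; rewrite leqNgt; apply/negP => ltb; case/negP: (Fm0).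
have m0r : (m0 s <= r)%N by rewrite -(hF _ Fm0) mE leq_addr.
have := congr1 (fun q : {poly {mpoly K[n.+1]}} => (q`_(r - m0 s))@_(E m0)) gP.
rewrite /= coefXnM ifT; last by lia.
rewrite mcoeff0 /mmap coef_sum raddf_sum /= => <-.
rewrite (bigD1_seq m0) ?mcoeff_msupp ?msupp_uniq //=.
rewrite vE // mulrCA coefXnM ltnn subnn -polyCM coefC eqxx mcoeffCM mcoeffX eqxx.
rewrite mulr1 big_seq_cond big1 ?addr0 // => m /andP[]; rewrite mcoeff_msupp.
move=> Fm nm; rewrite vE // mulrCA coefXnM; case: ltnP => [_|le1]; first by rewrite mcoeff0.
rewrite -polyCM coefC; case: eqP => [le2|_]; last by rewrite mcoeff0.
rewrite mcoeffCM mcoeffX; case: eqP => [EE|_]; last by rewrite mulr0.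
have mr : (m s <= r)%N by rewrite -(hF _ Fm) mE leq_addr.
case/eqP: nm; apply/mnmP => t; move/mnmP/(_ t): EE; rewrite !mnmE.
by case: eqP => // -> _; lia.
Qed.

End CoordinatePoints.

(** * The Cremona map *)

Section UnitsModulo.
Variable R : comNzRingType.
Implicit Types (t x y : R).

Definition one_mod t x := exists q, x = 1 + t * q.

Lemma one_modM t x y : one_mod t x -> one_mod t y -> one_mod t (x * y).
Proof. by move=> [q ->] [q' ->]; exists (q + q' + t * q * q'); ring. Qed.

Lemma one_mod_prod t I (s : seq I) (P : pred I) (c : I -> R) :
  (forall i, one_mod t (c i)) -> one_mod t (\prod_(i <- s | P i) c i).
Proof.
move=> hc; apply: (big_ind (one_mod t)) => //; last exact: one_modM.
by exists 0; rewrite mulr0 addr0.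
Qed.

Lemma one_mod_exp t x k : one_mod t x -> one_mod t (x ^+ k).
Proof.
move=> hx; rewrite (_ : x ^+ k = \prod_(i < k) x); first exact: one_mod_prod.
by rewrite prodr_const card_ord.
Qed.

(** A truncated geometric series inverts [x = 1 + t q] modulo [t^m]. *)
Lemma one_mod_cancel t x y m :
  one_mod t x -> (exists g, x * y = t ^+ m * g) -> exists g, y = t ^+ m * g.
Proof.
move=> [q ->] [g gP]; pose s := \sum_(i < m) (- (t * q)) ^+ i.
have sE : (1 + t * q) * s = 1 - t ^+ m * (- q) ^+ m.
  by rewrite -exprMn mulrN -[RHS]opprB subrX1 -/s; ring.
exists (g * s + (- q) ^+ m * y).
rewrite -[LHS]mul1r -[1](subrK (t ^+ m * (- q) ^+ m)) -sE mulrDl.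
by rewrite -mulrA [s * y]mulrC mulrA gP; ring.
Qed.

End UnitsModulo.

Section Cremona.
Variables (K : fieldType) (n : nat).
Implicit Types (F G : {mpoly K[n.+1]}) (a : 'I_n.+1 -> K) (b m : 'X_{1..n.+1}).
Implicit Types (p q : 'rV[K]_n.+1) (r : nat).

(** For boxed forms of degree [r] this is [y^b F(a / y)] without denominators. Summing over all
    monomials of degree at most [r], instead of the support of [F], gives linearity on all
    polynomials. *)
Definition cremona r a b F : {mpoly K[n.+1]} :=
  \sum_(m : 'X_{1..n.+1 < r.+1}) (F@_m * mmap1 a m) *: 'X_[b - m].

Lemma cremona_linear r a b : linear (cremona r a b).
Proof.
move=> c F G; rewrite /cremona scaler_sumr -big_split; apply: eq_bigr => m _.
by rewrite /= mcoeffD mcoeffZ scalerA -scalerDl mulrDl mulrA.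
Qed.

HB.instance Definition _ r a b := GRing.isLinear.Build K {mpoly K[n.+1]}
  {mpoly K[n.+1]} _ (cremona r a b) (cremona_linear r a b).

Definition boxed b F := forall m, F@_m != 0 -> (m <= b)%MM.

Lemma cremonaE r a b F : F \is r.-homog ->
  cremona r a b F = \sum_(m <- msupp F) (F@_m * mmap1 a m) *: 'X_[b - m].
Proof.
move=> /homog_mdegP hF; set I : subFinType _ := 'X_{1..n.+1 < r.+1}.
rewrite (big_mksub I) ?msupp_uniq //=; last first.
  by move=> m; rewrite mcoeff_msupp => /hF ->.
rewrite big_rmcond // => m /memN_msupp_eq0 ->.
by rewrite mul0r scale0r.
Qed.

Lemma boxed_mdegB r r' b F m :
  F \is r.-homog -> boxed b F -> (mdeg b = r + r')%N -> F@_m != 0 ->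
  mdeg (b - m) = r'.
Proof.
move=> /homog_mdegP hF hb br Fm; have := mdegD (b - m) m.
by rewrite submK ?hb // br (hF _ Fm); lia.
Qed.

Lemma cremona_homog r r' a b F :
  F \is r.-homog -> boxed b F -> (mdeg b = r + r')%N ->
  cremona r a b F \is r'.-homog.
Proof.
move=> hF hb br; rewrite cremonaE // big_seq; apply: rpred_sum => m.
rewrite mcoeff_msupp => Fm; rewrite rpredZ // dhomogX; apply/eqP.
exact: boxed_mdegB hF hb br Fm.
Qed.

Lemma cremona_boxed r a b F : boxed b (cremona r a b F).
Proof.
move=> m; rewrite /cremona raddf_sum /=; apply: contraR => /mnm_lepP nm.
rewrite big1 // => i _; rewrite mcoeffZ mcoeffX; case: eqP => [E|_].
  by case: nm => s; rewrite -E mnmBE leq_subr.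
by rewrite mulr0.
Qed.

Lemma mmap1D (S : comNzRingType) (u : 'I_n.+1 -> S) m m' :
  mmap1 u (m + m') = mmap1 u m * mmap1 u m'.
Proof. by rewrite commr_mmap1_M // => *; exact: mulrC. Qed.

Lemma cremonaK r r' a b F :
  F \is r.-homog -> boxed b F -> (mdeg b = r + r')%N ->
  cremona r' a b (cremona r a b F) = mmap1 a b *: F.
Proof.
move=> hF hb br; rewrite (cremonaE a b hF) linear_sum.
rewrite [in RHS](mpolyE F) scaler_sumr big_seq [RHS]big_seq.
apply: eq_bigr => m; rewrite mcoeff_msupp => Fm; have hm := hb _ Fm.
have dm : mdeg (b - m) = r' by exact: boxed_mdegB hF hb br Fm.
rewrite linearZ /= cremonaE; last by rewrite dhomogX; apply/eqP.
rewrite msuppX big_seq1 mcoeffX eqxx mul1r !scalerA.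
have -> : (b - (b - m) = m)%MM.
  by apply/mnmP => s; rewrite !mnmBE subKn //; move/mnm_lepP: hm; apply.
by rewrite -mulrA -mmap1D [(m + _)%MM]addmC submK // mulrC.
Qed.

(** With [v = c a / u], homogeneity gives [u^b F(a / u) = u^b F(v) / c^r]; the statement is cleared
    of denominators. *)
Lemma mmap_cremona (S : comNzRingType) (f : {rmorphism K -> S}) c u v r a b F :
  F \is r.-homog -> boxed b F -> (forall s, c * f (a s) = u s * v s) ->
  c ^+ r * mmap f u (cremona r a b F) = mmap1 u b * mmap f v F.
Proof.
move=> hF hb cuv; rewrite cremonaE // raddf_sum /= /mmap !mulr_sumr.
rewrite big_seq [RHS]big_seq.
apply: eq_bigr => m; rewrite mcoeff_msupp => Fm; have hm := hb _ Fm.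
rewrite -/(mmap _ _ _) mmapZ mmapX rmorphM /= -[in RHS](submK hm) mmap1D.
have : c ^+ r * f (mmap1 a m) = mmap1 u m * mmap1 v m.
  move/homog_mdegP: hF => /(_ _ Fm) <-; rewrite mdegE -prodrXr rmorph_prod.
  rewrite /mmap1 -!big_split; apply: eq_bigr => s _ /=.
  by rewrite rmorphXn -!exprMn cuv.
move=> E; transitivity (f F@_m * mmap1 u (b - m)%MM * (c ^+ r * f (mmap1 a m))).
  ring.
by rewrite E; ring.
Qed.

(* The Cremona map y |-> p q / y exchanges p and q; clearing denominators along
   the line p + t v turns it into t |-> q E(t), where E(t) = 1 mod t. *)
Lemma vanish_order_cremona r k a b p q F : F \is r.-homog -> boxed b F ->
  (forall s, p 0 s != 0) -> (forall s, a s = p 0 s * q 0 s) ->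
  vanish_order q k F -> vanish_order p k (cremona r a b F).
Proof.
move=> hF hb p0 apq hq v.
(* Here [p_s c_s] is the [s]-th coordinate of the curve [p + t v]. Multiplying [q_s / c_s] by the
   product of all the [c] leaves [q_s E_s]. *)
pose c s := 1 + 'X * (polyCC n (p 0 s)^-1 * v s).
have c1 s : one_mod 'X (c s) by exists (polyCC n (p 0 s)^-1 * v s).
pose E s := \prod_(t | t != s) c t.
have /fin_all_exists[w wE] : forall s, one_mod 'X (E s).
  by move=> s; exact: one_mod_prod.
(* The image curve [q E = q + t q w] is in general not a line, so vanishing at [q] is applied with a
   direction that itself depends on [t]. *)
have [g gP] := hq (fun s => polyCC n (q 0 s) * w s).
apply: (@one_mod_cancel _ _ ((\prod_s c s) ^+ r)).
  exact/one_mod_exp/one_mod_prod.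
set u := fun s => _ + _.
rewrite (mmap_cremona (v := fun s => polyCC n (q 0 s) * E s)) //; last first.
  move=> s; rewrite (bigD1 s) //= -/(E s) /u /c apq rmorphM /=.
  have : polyCC n (p 0 s) * polyCC n (p 0 s)^-1 = 1.
    by rewrite -rmorphM divff ?rmorph1.
  move=> pV; transitivity ((polyCC n (p 0 s) + 'X *
     (polyCC n (p 0 s) * polyCC n (p 0 s)^-1) * v s) * (polyCC n (q 0 s) * E s)).
    ring.
  by rewrite pV mulr1.
exists (mmap1 u b * g); rewrite mulrCA -gP; congr (_ * _); apply: eq_mmap => s.
by rewrite wE; ring.
Qed.

End Cremona.

(** * Flipping pairs of points *)

Section Flip.
Variables (K : fieldType) (n : nat).
Implicit Types (F G : {mpoly K[n.+1]}) (p q : 'rV[K]_n.+1) (r : nat).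

(* [boxed b F] expresses the vanishing orders at the coordinate points. *)
Definition coord_system r (b : 'X_{1..n.+1}) p q kp kq F :=
  [/\ F \is r.-homog, boxed b F, vanish_order p kp F & vanish_order q kq F].

Lemma cremona_coord_system r r' a b p q kp kq F :
  (forall s, p 0 s != 0) -> (forall s, q 0 s != 0) ->
  (forall s, a s = p 0 s * q 0 s) -> (mdeg b = r + r')%N ->
  coord_system r b p q kp kq F ->
  coord_system r' b p q kq kp (cremona r a b F).
Proof.
move=> p0 q0 apq br [hF hb hp hq]; split.
- exact: cremona_homog br.
- exact: cremona_boxed.
- exact: vanish_order_cremona apq hq.
- by apply: vanish_order_cremona hp => // s; rewrite mulrC.
Qed.

(** The Cremona map with [a = p q] is invertible up to the scalar [a^b], which is nonzero because no
    coordinate of [p] or [q] vanishes. *)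
Lemma coord_system_flip r r' b p q kp kq D :
  (forall s, p 0 s != 0) -> (forall s, q 0 s != 0) -> (mdeg b = r + r')%N ->
  has_dim (coord_system r' b p q kq kp) D ->
  has_dim (coord_system r b p q kp kq) D.
Proof.
move=> p0 q0 br; have br' : (mdeg b = r' + r)%N by rewrite addnC.
pose a s := p 0 s * q 0 s.
apply: (has_dim_transfer (f := cremona r a b) (g := cremona r' a b)
  (a := mmap1 a b)).
- by apply/prodf_neq0 => s _; rewrite expf_neq0 // mulf_neq0.
- by move=> F; exact: cremona_coord_system.
- by move=> F; exact: cremona_coord_system.
- by move=> F [hF hb _ _]; exact: cremonaK.
- by move=> F [hF hb _ _]; exact: cremonaK.
Qed.

Variables (N : nat) (P : 'I_N -> 'rV[K]_n.+1).

(* The truncation in [r - b k] is harmless: the condition is void for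
   [r <= b k]. *)
Definition vanish_system r (b : 'I_N -> nat) F :=
  F \is r.-homog /\ forall k, vanish_order (P k) (r - b k) F.

Definition general_points := forall e : 'I_n.+1 -> 'I_N, injective e ->
  \matrix_s P (e s) \in unitmx.

Section Coordinates.
Variables (e : 'I_n.+1 -> 'I_N) (i j : 'I_N).
Let M := \matrix_s P (e s).
Hypothesis unitM : M \in unitmx.
Hypothesis e_surj : forall k, k != i -> k != j -> exists s, e s = k.
Let p := P i *m invmx M.
Let q := P j *m invmx M.

(** In the coordinates given by [M], the points [P (e s)] become the coordinate points, where
    vanishing is a bound on exponents, and [P i], [P j] become [p], [q]. *)
Lemma vanish_system_coord r (b : 'I_N -> nat) D :
  has_dim (vanish_system r b) D <->
  has_dim (coord_system r [multinom b (e s) | s < n.+1] p q (r - b i) (r - b j)) D.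
Proof.
have MK F : lin_subst (invmx M) (lin_subst M F) = F.
  by rewrite lin_substM mulVmx ?lin_subst1.
have KM F : lin_subst M (lin_subst (invmx M) F) = F.
  by rewrite lin_substM mulmxV ?lin_subst1.
have dM s : delta_mx 0 s *m M = P (e s).
  by rewrite -rowE rowK.
have VW F : vanish_system r b F ->
   coord_system r [multinom b (e s) | s < n.+1] p q (r - b i) (r - b j) (lin_subst M F).
  move=> [hF hv]; have hF' := lin_subst_homog M hF; split=> //.
  - move=> m Fm; apply/mnm_lepP => s; rewrite mnmE.
    apply: (iffLR (vanish_order_delta (b (e s)) s hF')) Fm.
    by apply: vanish_order_lin_subst; rewrite dM.
  - by apply: vanish_order_lin_subst; rewrite /p mulmxKV.
  - by apply: vanish_order_lin_subst; rewrite /q mulmxKV.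
have WV F : coord_system r [multinom b (e s) | s < n.+1] p q (r - b i) (r - b j) F ->
   vanish_system r b (lin_subst (invmx M) F).
  move=> [hF hb hp hq]; split=> [|k]; first exact: lin_subst_homog.
  apply: vanish_order_lin_subst.
  have [->//|ki] := eqVneq k i; have [->//|kj] := eqVneq k j.
  have [s <-] := e_surj ki kj; rewrite -dM mulmxK //.
  apply/vanish_order_delta => // m /hb /mnm_lepP /(_ s).
  by rewrite mnmE.
split.
  apply: (has_dim_transfer (f := lin_subst (invmx M)) (g := lin_subst M)
    (oner_neq0 K) WV VW) => F _; first by rewrite scale1r; exact: KM.
  by rewrite scale1r; exact: MK.
apply: (has_dim_transfer (f := lin_subst M) (g := lin_subst (invmx M))
    (oner_neq0 K) VW WV) => F _; first by rewrite scale1r; exact: MK.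
by rewrite scale1r; exact: KM.
Qed.
End Coordinates.

(** A zero coordinate at [s] would make [P i] a combination of the points [P (e t)] with [t != s],
    so that replacing [P (e s)] by [P i] would give dependent points. *)
Lemma general_points_coord_neq0 (e : 'I_n.+1 -> 'I_N) i s :
  general_points -> injective e -> (forall s, e s != i) ->
  (P i *m invmx (\matrix_s P (e s))) 0 s != 0.
Proof.
move=> gP einj ei; set M := \matrix_s _; set p := P i *m _.
have pM : p *m M = P i by rewrite mulmxKV //; exact: gP.
pose e' t := if t == s then i else e t.
have e'_inj : injective e'.
  move=> t1 t2; rewrite /e'; case: eqVneq => [->|_]; case: eqVneq => [->|_] //.
  - by move=> E; move: (ei t2); rewrite -E eqxx.
  - by move=> E; move: (ei t1); rewrite E eqxx.
  - exact: einj.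
have := gP _ e'_inj; set M' := \matrix_s _ => uM'.
apply/eqP => ps0; pose c := delta_mx 0 s - p.
have cM' : c *m M' = 0.
  rewrite mulmxBl -rowE rowK /e' eqxx -pM.
  apply/eqP; rewrite subr_eq0; apply/eqP.
  rewrite !mulmx_sum_row; apply: eq_bigr => t _; rewrite !rowK /e'.
  by case: eqVneq => // ->; rewrite ps0 !scale0r.
have : c 0 s = 0 by rewrite -[c](mulmxK uM') cM' mul0mx mxE.
by rewrite mxE [X in _ + X]mxE ps0 mxE !eqxx subr0 => /eqP; rewrite oner_eq0.
Qed.

End Flip.

Lemma enum_compl2 n (i j : 'I_(n + 3)) : i != j ->
  exists e : 'I_n.+1 -> 'I_(n + 3),
  [/\ injective e, forall s, e s != i, forall s, e s != j,
      forall k, k != i -> k != j -> exists s, e s = k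
    & forall b : 'I_(n + 3) -> nat,
        (\sum_k b k = b i + b j + \sum_s b (e s))%N].
Proof.
move=> ij; pose A := ~: [set i; j].
have cA : n.+1 = #|A|.
  by have := cardsC [set i; j]; rewrite cards2 ij card_ord -/A; lia.
have eA s : enum_val (cast_ord cA s) \in A by exact: enum_valP.
exists (fun s => enum_val (cast_ord cA s)); split.
- by move=> s t /enum_val_inj /cast_ord_inj.
- by move=> s; have := eA s; rewrite !inE negb_or => /andP[].
- by move=> s; have := eA s; rewrite !inE negb_or => /andP[].
- move=> k ki kj; have kA : k \in A by rewrite !inE negb_or ki.
  by exists (cast_ord (esym cA) (enum_rank_in kA k)); rewrite cast_ordKV enum_rankK_in.
move=> b; rewrite (bigD1 i) //= (bigD1 j) 1?eq_sym //= addnA; congr (_ + _)%N.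
rewrite -(reindex (cast_ord cA) (F := fun s => b (enum_val s)) (P := xpredT)); last first.
  by exists (cast_ord (esym cA)) => s _; rewrite ?cast_ordK ?cast_ordKV.
rewrite -big_enum_val; apply: eq_bigl => k.
by rewrite !inE negb_or.
Qed.

(** The two sum conditions say, without subtraction, that [w] is the sum of [b] minus [2 r], and
    that the box at the other [n + 1] points has degree [r + r']. *)
Lemma vanish_system_flip (K : fieldType) n (P : 'I_(n + 3) -> 'rV[K]_n.+1)
    i j w r r' (b b' : 'I_(n + 3) -> nat) D :
  general_points P -> i != j ->
  (b i + b' i = w)%N -> (b j + b' j = w)%N ->
  (forall k, k != i -> k != j -> b' k = b k) ->
  (\sum_k b k = w + 2 * r)%N -> (\sum_k b k = r + r' + b i + b j)%N ->
  has_dim (vanish_system P r' b') D -> has_dim (vanish_system P r b) D.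
Proof.
move=> gP ij bi bj bb' sb sb'.
have [e [einj ei ej esurj esum]] := enum_compl2 ij.
have uM := gP _ einj.
move=> /(iffLR (vanish_system_coord uM esurj r' b' D)) h.
apply/(vanish_system_coord uM esurj); move: h.
have -> : [multinom b' (e s) | s < n.+1] = [multinom b (e s) | s < n.+1].
  by apply/mnmP => s; rewrite !mnmE bb'.
(* The new orders at [i] and [j] are the old ones exchanged, as the Cremona map requires. *)
have -> : (r' - b' i = r - b j)%N by lia.
have -> : (r' - b' j = r - b i)%N by lia.
apply: coord_system_flip.
- by move=> s; exact: general_points_coord_neq0.
- by move=> s; exact: general_points_coord_neq0.
rewrite mdegE; under eq_bigr => s _ do rewrite mnmE.
by have := esum b; lia.
Qed.

Lemma sum_step N c x y : (c <= N)%N ->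
  (\sum_(k < N) (if k < c then x else y) = c * x + (N - c) * y)%N.
Proof.
elim: N => [|N IH]; first by rewrite leqn0 => /eqP ->; rewrite big_ord0.
rewrite leq_eqVlt => /predU1P[-> | cN].
  rewrite subnn addn0; under eq_bigr => k _ do rewrite ltn_ord.
  by rewrite sum_nat_const card_ord.
by rewrite big_ord_recr /= IH // ifF ?subSn // ?mulSn; lia.
Qed.

(** Every flip has the same [w = x + y], turns two values [x] into [y] and changes the degree by
    [y - x]; the pairs are taken consecutively from the first point on. *)
Lemma vanish_system_flips (K : fieldType) n (P : 'I_(n + 3) -> 'rV[K]_n.+1)
    x y r r' J D :
  general_points P -> ((n + 2) * x = y + 2 * r)%N -> (J.*2 <= n + 3)%N ->
  (r + J * y = r' + J * x)%N ->
  has_dim (vanish_system P r' (fun k => if (k < J.*2)%N then y else x)) D ->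
  has_dim (vanish_system P r (fun=> x)) D.
Proof.
move=> gP hw; elim: J r' => [|J IH] r' hJ hr'.
  by rewrite (_ : r' = r) //; lia.
(* The degree after [J] flips. The subtraction is exact: for [y < x] the degrees decrease, and one
   more flip still leads to the natural number [r']. *)
move=> hD; pose r1 := (r + J * y - J * x)%N.
have hr1 : (r + J * y = r1 + J * x)%N by rewrite /r1; nia.
apply: IH hr1 _; first by lia.
have l1 : (J.*2 < n + 3)%N by lia.
have l2 : (J.*2.+1 < n + 3)%N by lia.
apply: (vanish_system_flip (i := Ordinal l1) (j := Ordinal l2) (w := x + y)) hD => //.
- by rewrite -val_eqE /=; lia.
- by rewrite /= ltnn doubleS; case: ltnP => //; lia.
- by rewrite /= ifF ?ifT //; lia.
- move=> k; rewrite -!val_eqE /= => k1 k2.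
  by rewrite (_ : (k < J.+1.*2)%N = (k < J.*2)%N) //; lia.
- rewrite sum_step; last by lia.
  have [c cE] : exists c, (n + 3 = J.*2 + c)%N by exists (n + 3 - J.*2)%N; lia.
  rewrite cE addKn -mul2n; nia.
rewrite sum_step; last by lia.
have [c cE] : exists c, (n + 3 = J.*2 + c)%N by exists (n + 3 - J.*2)%N; lia.
rewrite /= ltnn ifF; last by lia.
rewrite cE addKn -mul2n; nia.
Qed.

(** * Void vanishing conditions and the critical degree *)

Lemma has_dim_homog (K : fieldType) n r :
  has_dim (fun F : {mpoly K[n.+1]} => F \is r.-homog) 'C(n + r, n).
Proof.
have <- : dim (dhomog n.+1 K r) = 'C(n + r, n).
  by rewrite -(bin_sub (leq_addr r n)) addKn addnC.
pose h i : dhomog n.+1 K r := r2v (delta_mx 0 i).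
have hE (c : 'I__ -> K) : \sum_i c i *: val (h i) = val (r2v (\row_i c i) : dhomog n.+1 K r).
  rewrite [\row_i c i]row_sum_delta !raddf_sum; apply: eq_bigr => i _.
  by rewrite mxE /= linearZ.
exists (fun i => val (h i)); split=> [i|c|F hF].
- exact: dhomog_is_dhomog.
- rewrite hE => c0 i; have : r2v (\row_i c i) = 0 :> dhomog n.+1 K r by exact: val_inj.
  move/(congr1 v2r); rewrite r2vK linear0 => /rowP/(_ i).
  by rewrite !mxE.
exists (fun i => v2r (DHomog hF) 0 i); rewrite hE.
rewrite (_ : \row_i _ = v2r (DHomog hF)) ?v2rK //.
by apply/rowP => i; rewrite mxE.
Qed.

Lemma general_points_dual (K : fieldType) n N (l : 'I_N -> {mpoly K[n.+1]}) :
  linearly_general_position l -> general_points (fun k => dual_point (l k)).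
Proof.
move=> gl e einj; set M := \matrix_s _.
pose J := [set e s | s in 'I_n.+1].
have cJ : #|J| = n.+1 by rewrite card_imset // card_ord.
have := gl J; rewrite cJ leqnn => /(_ isT); set X := [seq _ | i in J] => dX.
have spanX : <<X>>%VS = fullv.
  by apply/eqP; rewrite eqEdim subvf dimvf dX /dim /= mul1n.
suff : row_full M by rewrite row_full_unit.
rewrite -sub1mx; apply/row_subP => t.
have : row t 1%:M \in <<X>>%VS by rewrite spanX memvf.
move=> /(coord_span (X := in_tuple X)) ->.
apply: summx_sub => i _; apply: scalemx_sub.
have : (in_tuple X)`_i \in X by exact: mem_nth.
case/mapP => k; rewrite mem_enum => /imsetP[s _ ->] ->.
by rewrite -[X in (X <= _)%MS](rowK (fun s => dual_point (l (e s)))) row_sub.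
Qed.

(** The last hypothesis says that after [J] flips all orders of vanishing truncate to zero, so the
    system consists of all forms of degree [r']. *)
Lemma graded_quot_dim_powers (K : fieldType) n (l : 'I_(n + 3) -> {mpoly K[n.+1]})
    e y r r' J :
  (forall i, l i \is 1.-homog) -> linearly_general_position l ->
  pchar0_or_gt K r ->
  ((n + 2) * e = y + 2 * r)%N -> (J.*2 <= n + 3)%N ->
  (r + J * y = r' + J * e)%N ->
  (forall k : 'I_(n + 3), r' <= if (k < J.*2)%N then y else e)%N ->
  graded_quot_dim (gen_ideal (fun i => l i ^+ e.+1)) r 'C(n + r', n).
Proof.
move=> hl gl hK hy hJ hr' le_r'.
apply: graded_quot_dim_inverse_system => //.
pose P k := dual_point (l k).
apply: (has_dim_iff (P := vanish_system P r (fun=> e))).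
  move=> F; split=> -[hF hv]; split=> // k.
    by apply: (iffLR (vanish_order_dirderiv e (P k) hK hF)); exact: hv.
  by apply: (iffRL (vanish_order_dirderiv e (P k) hK hF)); exact: hv.
apply: vanish_system_flips hr' _ => //; first exact: general_points_dual.
apply: has_dim_iff (has_dim_homog K n r') => F.
split=> [hF|[]//]; split=> // k v; have := le_r' k; rewrite -subn_eq0 => /eqP ->.
by eexists; rewrite expr0 mul1r.
Qed.

(** By nested floor division, [crit_deg n d] and [rho n d] are quotient and remainder of [A] by
    [n + 2], which bounds [rho]. *)
Lemma odd_crit_degE n d : odd n ->
  let A := ((n + 1) * (n + 3) * (d - 1) %/ 2)%N in
  [/\ (2 * A = (n + 1) * (n + 3) * (d - 1))%N, crit_deg n d = (A %/ (n + 2))%N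
    & rho n d = (A %% (n + 2))%N%:Z].
Proof.
move=> oddn A.
have A2 : (2 * A = (n + 1) * (n + 3) * (d - 1))%N.
  by rewrite mulnC divnK // dvdn2 !oddM oddD oddn.
have cE : crit_deg n d = (A %/ (n + 2))%N by rewrite /crit_deg oddn -divnMA.
split=> //; rewrite /rho cE -/A; have := divn_eq A (n + 2).
by move: A {A2 cE} => A; move: (A %/ _)%N (A %% _)%N => q t ->; lia.
Qed.

Theorem proposition4p1 (K : fieldType) (n d : nat)
    (l : 'I_(n + 3) -> {mpoly K[n.+1]}) :
  (2 <= n)%N -> (0 < d)%N ->
  (forall i, l i \is 1.-homog) ->
  linearly_general_position l ->
  let r := crit_deg n d in
  let I := gen_ideal (fun i => l i ^+ d) in
  [/\ ~~ odd n -> pchar0_or_gt K r -> graded_quot_dim I r 1,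
      odd n -> 0 <= rho n d <= (n + 1)%N%:Z
    & odd n -> (n + 2 %| d - 1)%N || (n ^ 2 + n + 2 <= d)%N ->
      pchar0_or_gt K r -> graded_quot_dim I r 'C(n + `|rho n d|, n)].
Proof.
move=> n2; case: d => // e _ hl gl r I; rewrite {}/I.
split=> [evenn hK | oddn | oddn hd hK].
- have rE : (2 * r = (n + 2) * e)%N.
    rewrite /r /crit_deg (negPf evenn) subn1 mulnC divnK //.
    by rewrite dvdn2 oddM oddD (negPf evenn).
  have nE := odd_double_half (n + 2); rewrite oddD (negPf evenn) add0n in nE.
  (* Here [y = 0], and [(n + 2) / 2] flips leave only the last point with the value [e], in degree
     0. *)
  have := @graded_quot_dim_powers K n l e 0 r 0 (n + 2)./2 hl gl hK.
  by rewrite addn0 binn; apply=> //; nia.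
- have [_ _ ->] := odd_crit_degE e.+1 oddn.
  by have := ltn_pmod ((n + 1) * (n + 3) * (e.+1 - 1) %/ 2) (isT : 0 < n.+2)%N; lia.
have [A2 cE ->] := odd_crit_degE e.+1 oddn; rewrite absz_nat.
move: A2 cE; set A := (_ %/ 2)%N; rewrite -/r subn1 /= => A2 cE.
have nE := odd_double_half (n + 3); rewrite oddD oddn add0n in nE.
(* By [(n + 2) y = e + 2 t] below, this means [t <= y] for the remainder [t]. If [n + 2] divides
   [e], then [t = 0]; otherwise [t <= n + 1] and [n (n + 1) <= e]. *)
have ne : (n * (A %% (n + 2)) <= e)%N.
  case/orP: hd => [|le]; last first.
    have := ltn_pmod A (isT : 0 < n.+2)%N; rewrite -addn2 => ltA.
    have le_t : (A %% (n + 2) <= n + 1)%N by lia.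
    by apply: leq_trans (leq_mul (leqnn n) le_t) _; move: le; rewrite -mulnn; lia.
  rewrite subn1 /= => /dvdnP[c ec].
  have -> : (A = (n + 1) * (n + 3)./2 * c * (n + 2))%N.
    by move: nE A2; set h := _./2 => <-; rewrite ec; lia.
  by rewrite modnMl muln0.
have := divn_eq A (n + 2); rewrite -cE.
move: (A %% _)%N ne => t ne AE.
have n2_gt0 : (0 < n + 2)%N by rewrite addn2.
(* Such a [y] exists because [2 (n + 2) r <= 2 A = ((n + 2)^2 - 1) e]. *)
have [y yE] : exists y, ((n + 2) * e = y + 2 * r)%N.
  exists ((n + 2) * e - 2 * r)%N; rewrite subnK //.
  by rewrite -(leq_pmul2l n2_gt0); lia.
have yE2 : ((n + 2) * y = e + 2 * t)%N.
  by have := congr1 (muln (n + 2)) yE; lia.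
have ty : (t <= y)%N by rewrite -(leq_pmul2l n2_gt0); lia.
have hJ : ((n + 3)./2.*2 <= n + 3)%N by lia.
(* All [n + 3] points are flipped; adding [yE] and [yE2] shows that the final degree is [t]. *)
apply: (graded_quot_dim_powers hl gl hK yE hJ).
  move: nE; set h := _./2 => nE.
  have := congr1 (muln^~ y) nE; have := congr1 (muln^~ e) nE; rewrite /=; lia.
by move=> k; case: ifP; have := ltn_ord k; lia.
Qed.
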